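(* Let $\mathfrak{g}$ be a finite-dimensional real nilpotent Lie algebra admitting a derivation $f:\mathfrak{g}\to\mathfrak{g}$ whose restriction to the derived subalgebra $[\mathfrak{g},\mathfrak{g}]$ is regular, i.e. $f|_{[\mathfrak{g},\mathfrak{g}]}:[\mathfrak{g},\mathfrak{g}]\to[\mathfrak{g},\mathfrak{g}]$ is invertible. Then $\mathfrak{g}$ admits an affine structure.
   Context: All Lie algebras are finite-dimensional and real. An affine structure on a Lie algebra $\mathfrak{g}$ is a bilinear map $\nabla:\mathfrak{g}\times\mathfrak{g}\to\mathfrak{g}$, written $(X,Y)\mapsto X\cdot Y=\nabla_X Y$, such that for all $X,Y,Z\in\mathfrak{g}$: (1) $X\cdot(Y\cdot Z)-Y\cdot(X\cdot Z)=(X\cdot Y)\cdot Z-(Y\cdot X)\cdot Z$; (2) $X\cdot Y-Y\cdot X=[X,Y]$. (Equivalently, the torsion $\nabla_XY-\nabla_YX-[X,Y]$ and the curvature $\nabla_X\nabla_Y-\nabla_Y\nabla_X-\nabla_{[X,Y]}$ vanish.) A derivation of $\mathfrak{g}$ is a linear map $f:\mathfrak{g}\to\mathfrak{g}$ with $f([X,Y])=[f(X),Y]+[X,f(Y)]$; every derivation leaves $[\mathfrak{g},\mathfrak{g}]$ (the span of all brackets) invariant. ''Regular'' means non-singular (invertible). *)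

(* Defs.v *)
From HB Require Import structures.
From mathcomp Require Import all_boot all_algebra sesquilinear.
From mathcomp Require Import boolp classical_sets functions reals.

Set Implicit Arguments.
Unset Strict Implicit.
Unset Printing Implicit Defensive.

Import GRing.Theory.
Local Open Scope ring_scope.

(* A vectType is finite-dimensional, hence so is every lieAlgType. *)
HB.mixin Record Vector_isLieAlgebra (K : fieldType) g of Vector K g := {
  lie : {bilinear g -> g -> g};
  liexx : forall x : g, lie x x = 0;
  lie_jacobi : forall x y z : g,
    lie x (lie y z) + lie y (lie z x) + lie z (lie x y) = 0
}.

#[short(type="lieAlgType")]
HB.structure Definition LieAlgebra (K : fieldType) :=
  {g of Vector_isLieAlgebra K g & Vector K g}.

Section LieAlgebraTheory.
Variables (K : fieldType) (g : lieAlgType K).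
Implicit Types (U V W : {vspace g}) (x y z : g) (f : 'End(g)).

(* The span of all brackets [u, v] with u in U and v in V (see liev_subP);
   as for prodv, it is enough to let u and v range over bases. *)
Definition liev U V : {vspace g} :=
  <<[seq lie u v | u <- vbasis U, v <- vbasis V]>>%VS.

Lemma memv_lie U V x y : x \in U -> y \in V -> lie x y \in liev U V.
Proof.
move=> /coord_vbasis -> /coord_vbasis ->.
rewrite linear_sumlz rpred_sum // => i _.
rewrite linear_sumr rpred_sum // => j _.
rewrite linearZl_LR linearZr_LR !memvZ // memv_span //.
by apply: allpairs_f; rewrite memt_nth.
Qed.

Lemma liev_subP U V W :
  reflect {in U & V, forall x y, lie x y \in W} (liev U V <= W)%VS.
Proof.
apply: (iffP idP) => [sW x y Ux Vy | sW].
  by rewrite (subvP sW) ?memv_lie.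
apply/span_subvP=> _ /allpairsP[[u v] /= [Uu Vv ->]].
by rewrite sW ?vbasis_mem.
Qed.

Definition derived_subalgebra : {vspace g} := liev fullv fullv.

Fixpoint lower_central_series (n : nat) : {vspace g} :=
  if n is m.+1 then liev fullv (lower_central_series m) else fullv.

Definition nilpotent_lie : Prop := exists n, lower_central_series n = 0%VS.

Definition derivation f : Prop :=
  forall x y, f (lie x y) = lie (f x) y + lie x (f y).

Lemma derivation_derived f : derivation f ->
  (f @: derived_subalgebra <= derived_subalgebra)%VS.
Proof.
move=> df.
apply/subvP=> _ /memv_imgP[x xD ->].
suff /subvP/(_ x xD) : (derived_subalgebra <= f @^-1: derived_subalgebra)%VS.
  by rewrite memv_preim.
apply/liev_subP=> u v _ _.
by rewrite -memv_preim df rpredD ?memv_lie ?memvf.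
Qed.

(* f maps U into U, and the induced endomorphism of U is invertible. *)
Definition regular_on U f : Prop :=
  set_bij [set x : g | x \in U] [set x : g | x \in U] f.

Definition affine_structure (nabla : {bilinear g -> g -> g}) : Prop :=
  (forall x y z, nabla x (nabla y z) - nabla y (nabla x z) =
                 nabla (nabla x y) z - nabla (nabla y x) z) /\
  (forall x y, nabla x y - nabla y x = lie x y).

End LieAlgebraTheory.

Arguments derived_subalgebra {K} g.
Arguments lower_central_series {K} g n.
Arguments nilpotent_lie {K} g.

(* Main.v *)
(** If [f] is invertible on the derived subalgebra then, as it contains every
    bracket [lie x (f y)], the product [x . y := f^-1 (lie x (f y))] makes
    sense. Applying [f], the torsion identity becomes the Leibniz rule of [f],
    and the curvature identity the Jacobi identity. *)

From HB Require Import structures.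
Require Import Defs.
From mathcomp Require Import all_boot all_algebra sesquilinear reals.
From mathcomp Require Import classical_sets functions.

Set Implicit Arguments.
Unset Strict Implicit.
Unset Printing Implicit Defensive.

Import GRing.Theory.

Local Open Scope ring_scope.

(** Extends the inverse of [f] on [U] to a linear map on all of [g], so that the product needs no
    subtype. *)
Lemma regular_on_section (K : fieldType) (g : lieAlgType K) (U : {vspace g})
    (f : 'End(g)) :
  regular_on U f ->
  exists2 h : 'End(g), forall x, h x \in U & {in U, cancel h f}.
Proof.
move=> [_ _ fsurj].
(* The pseudo-inverse of [f \o projv U] is a right inverse on its image, which contains [U] by
   surjectivity; the outer projection forces values into [U]. *)
exists (projv U \o (f \o projv U)^-1)%VF => [x | x Ux].
  by rewrite comp_lfunE memv_proj.
rewrite comp_lfunE -[f _]comp_lfunE limg_lfunVK //.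
have [y Uy <-] := fsurj x Ux.
by rewrite -[y in f y](projv_id Uy) -comp_lfunE memv_img ?memvf.
Qed.

Section TwistedBracket.
Variables (K : fieldType) (g : lieAlgType K) (h f : 'End(g)).

Definition twisted_lie (x y : g) : g := h (lie x (f y)).

Fact twisted_lie_is_bilinear :
  bilinear_for (GRing.Scale.Law.clone _ _ *:%R _)
    (GRing.Scale.Law.clone _ _ *:%R _) twisted_lie.
Proof.
split=> [z a x y | z a x y]; rewrite /twisted_lie.
  by rewrite linearPl linearP.
by rewrite !linearP.
Qed.

HB.instance Definition _ :=
  bilinear_isBilinear.Build K g g g *:%R *:%R twisted_lie
    twisted_lie_is_bilinear.

End TwistedBracket.

Lemma lieC (K : fieldType) (g : lieAlgType K) (x y : g) : lie x y = - lie y x.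
Proof.
apply/eqP; rewrite -addr_eq0; have := liexx (x + y).
by rewrite linearDl !linearDr !liexx add0r addr0 => /eqP.
Qed.

Theorem theorem4p1 (R : realType) (g : lieAlgType R) (f : 'End(g)) :
  nilpotent_lie g ->
  derivation f ->
  regular_on (derived_subalgebra g) f ->
  exists nabla : {bilinear g -> g -> g}, affine_structure nabla.
Proof.
move=> _ df regf; have [h hD hK] := regular_on_section regf.
have lieD (x y : g) : lie x y \in derived_subalgebra g by rewrite memv_lie ?memvf.
have torsion (x y : g) : h (lie x (f y)) - h (lie y (f x)) = lie x y.
  have [_ finj _] := regf.
  (* Both sides lie in the derived subalgebra, where [f] is injective. *)
  apply: finj; rewrite ?inE /=; [exact: rpredB | exact: lieD |].
  by rewrite linearB /= !hK // df [lie y _]lieC opprK addrC.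
exists (@twisted_lie R g h f); split=> [x y z | x y] /=; last exact: torsion.
(* By [torsion] the right side is [h (lie (lie x y) (f z))]; on the left, [f] cancels each inner
   [h], leaving Jacobi for [x], [y], [f z] under [h]. *)
rewrite -[RHS](linearBl (twisted_lie h f)) /= /twisted_lie torsion.
rewrite !hK // -linearB; congr (h _).
have := lie_jacobi x y (f z).
rewrite [lie (f z) (lie x y)]lieC [lie (f z) x]lieC linearNr.
by move/eqP; rewrite subr_eq0 => /eqP.
Qed.
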